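(* The sequence $a_n=\det(-1;T_0,T_2,\ldots,T_{2n-2})$ ($n\ge2$) satisfies $a_2=1$, $a_3=2$, and $a_n=3a_{n-1}+2a_{n-2}$ for all $n\geq4$.
   Context: The tribonacci numbers are $T_0=T_1=0$, $T_2=1$, $T_n=T_{n-1}+T_{n-2}+T_{n-3}$ for $n\geq3$. For numbers $a_0,\ldots,a_n$, $\det(a_0;a_1,\ldots,a_n)$ denotes the determinant of the $n\times n$ Toeplitz--Hessenberg matrix whose $(i,j)$ entry is $a_{i-j+1}$ if $i-j+1\ge0$ and $0$ otherwise; here the $k$-th entry after the semicolon is $T_{2k-2}$. *)

(* Defs.v *)
From mathcomp Require Import all_boot all_order all_algebra.

Set Implicit Arguments.
Unset Strict Implicit.
Unset Printing Implicit Defensive.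

Import GRing.Theory.
Local Open Scope ring_scope.

Fixpoint trib (n : nat) : nat :=
  match n with
  | 0 | 1 => 0%N
  | 2 => 1%N
  | ((m.+1 as m1).+1 as m2).+1 => (trib m2 + trib m1 + trib m)%N
  end.

(* The tuple [a] lists a_1, ..., a_n, so that a_k = nth 0 (a0 :: a) k for
   0 <= k <= n.  Row and column indices start at 0, which leaves i - j + 1
   unchanged; the guard j <= i + 1 makes the truncated subtraction exact. *)
Definition toeplitz_hessenberg (R : comNzRingType) (n : nat) (a0 : R)
    (a : n.-tuple R) : 'M[R]_n :=
  \matrix_(i, j) if (j <= i.+1)%N then nth 0 (a0 :: a) (i.+1 - j) else 0.

(* Main.v *)
Require Import Defs.
From mathcomp Require Import all_boot all_order all_algebra.
From mathcomp Require Import ring zify.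
Import GRing.Theory.
Local Open Scope ring_scope.

(** With [a_0 = -1], the recurrence [d_m = \sum_(1 <= k <= m) a_k d_(m-k)] says
    that the Toeplitz-Hessenberg matrix sends [(d_0, ..., d_(n-1))] to
    [(0, ..., 0, d_n)]. Hence putting this combination of the columns in place
    of the first one leaves the determinant unchanged and shows that it is
    [d_n]. For [a_k = T_(2k-2)] the generating function of the [a_k] is
    [(x^2 - x^3) / (1 - 3x - x^2 - x^3)], so that of the determinants is
    [(1 - 3x - x^2 - x^3) / (1 - 3x - 2x^2)]. *)

Lemma det_toeplitz_hessenbergN1 (R : comNzRingType) (n : nat) (a : n.-tuple R)
    (d : nat -> R) :
    d 0%N = 1 ->
    (forall m, (m < n)%N -> d m.+1 = \sum_(k < m.+1) a`_(m - k) * d k) ->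
  \det (toeplitz_hessenberg (-1) a) = d n.
Proof.
case: n a => [|n] a d0 dS; first by rewrite det_mx00.
set M := toeplitz_hessenberg _ _.
(* Right multiplication by [U] replaces the first column; [U] is unitriangular because [d 0 = 1]. *)
pose U : 'M[R]_n.+1 := \matrix_(i, j) if j == 0 then d i else (i == j)%:R.
have detU : \det U = 1.
  rewrite det_trig; last first.
    apply/is_trig_mxP => i j ltij; rewrite mxE.
    by rewrite -!val_eqE /= (gtn_eqF (leq_ltn_trans (leq0n i) ltij)) (ltn_eqF ltij).
  rewrite big1 // => i _; rewrite mxE eqxx.
  by case: eqP => // ->.
have MU0 i : (M *m U) i 0 = if i == ord_max then d n.+1 else 0.
  rewrite mxE.
  under eq_bigr => k _ do rewrite !mxE eqxx.
  case: eqP => [->|/eqP iNn].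
    rewrite dS //; apply: eq_bigr => k _.
    by rewrite /= (ltnW (ltn_ord k)) subSn ?(ltn_ord k) // -ltnS.
  have lt_in : (i < n)%N.
    by rewrite ltn_neqAle -ltnS ltn_ord andbT.
  pose F k := (if (k <= i.+1)%N then nth 0 (-1 :: a) (i.+1 - k) else 0) * d k.
  rewrite -(big_mkord xpredT F) (big_cat_nat _ (n := i.+2)) //=.
  rewrite [X in _ + X]big_nat [X in _ + X]big1 ?addr0; last first.
    by move=> k /andP[ltik _]; rewrite /F leqNgt ltik mul0r.
  (* The superdiagonal term [- d i.+1] cancels the others by the recurrence. *)
  rewrite big_nat_recr //= {2}/F leqnn subnn mulN1r dS ?ltn_ord //.
  rewrite big_mkord; apply/eqP; rewrite subr_eq0; apply/eqP/eq_bigr => k _.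
  by rewrite /F (ltnW (ltn_ord k)) subSn // -ltnS.
have MUS i (j : 'I_n.+1) : j != 0 -> (M *m U) i j = M i j.
  move=> jN0; rewrite mxE (bigD1 j) //= big1 => [|k kNj].
    by rewrite !mxE (negPf jN0) eqxx mulr1 addr0.
  by rewrite [U _ _]mxE (negPf jN0) (negPf kNj) mulr0.
rewrite -[LHS]mulr1 -detU -det_mulmx (expand_det_col _ 0) (bigD1 ord_max) //=.
rewrite big1 ?addr0 => [|i iNn]; last by rewrite MU0 (negPf iNn) mul0r.
(* This minor is lower triangular with diagonal [-1], so its value [(-1)^n] cancels the cofactor
   sign. *)
rewrite MU0 eqxx /cofactor addn0 det_trig; last first.
  apply/is_trig_mxP => i j ltij; rewrite !mxE -/(M *m U).
  have -> : (\sum_k M (lift ord_max i) k * U k (lift 0 j))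
    = (M *m U) (lift ord_max i) (lift 0 j) by rewrite mxE.
  by rewrite MUS // mxE lift_max lift0 leqNgt !ltnS ltij.
rewrite (eq_bigr (fun=> -1)) => [|i _].
  by rewrite prodr_const card_ord -exprMn mulrNN mulr1 expr1n mulr1.
rewrite [LHS]mxE [LHS]mxE MUS // mxE lift_max lift0.
by rewrite leqnn subnn.
Qed.

(** If [x^3 = x^2 + x + 1], then squaring [x(x^2 - 1) = x^2 + 1] shows that [y = x^2] satisfies
    [y^3 = 3y^2 + y + 1]. *)
Lemma trib_double_rec (m : nat) :
  trib (2 * m.+3) = (3 * trib (2 * m.+2) + trib (2 * m.+1) + trib (2 * m))%N.
Proof.
have -> : (2 * m.+3 = (2 * m).+2.+4)%N by lia.
have -> : (2 * m.+2 = (2 * m).+4)%N by lia.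
have -> : (2 * m.+1 = (2 * m).+2)%N by lia.
move: (2 * m)%N => k.
have tE j : trib j.+3 = (trib j.+2 + trib j.+1 + trib j)%N by [].
rewrite !tE; lia.
Qed.

(** The recurrence fails at indices 2 and 3, so these values are explicit. *)
Fixpoint trib_det (n : nat) : int :=
  match n with
  | 0 => 1
  | 1 => 0
  | 2 => 1
  | 3 => 2
  | (m.+1 as m1).+1 => 3 * trib_det m1 + 2 * trib_det m
  end.

Lemma trib_det_rec (n : nat) :
  trib_det n.+4 = 3 * trib_det n.+3 + 2 * trib_det n.+2.
Proof. by []. Qed.

Lemma trib_det_conv (n : nat) :
  trib_det n.+1 = \sum_(k < n.+1) (trib (2 * (n - k)))%:Z * trib_det k.
Proof.
pose S n := \sum_(k < n.+1) (trib (2 * (n - k)))%:Z * trib_det k.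
have SE m : S m.+3 = 3 * S m.+2 + S m.+1 + S m + trib_det m.+2 - trib_det m.+1.
  (* Keeping the range fixed while shifting the index lets [trib_double_rec] act termwise. Each
     [S (m + j)] adds to [T j] only top terms, with coefficients [trib 0 = 0], [trib 2 = 1],
     [trib 4 = 2]. *)
  pose T j := \sum_(k < m.+1) (trib (2 * (m - k + j)))%:Z * trib_det k.
  have S0 : S m = T 0%N by apply: eq_bigr => k _; rewrite addn0.
  have ST j : \sum_(k < m.+1) (trib (2 * (m + j - k)))%:Z * trib_det k = T j.
    by apply: eq_bigr => k _; rewrite addnBAC // -ltnS.
  have TE : T 3%N = 3 * T 2%N + T 1%N + T 0%N.
    rewrite /T mulr_sumr -!big_split; apply: eq_bigr => k _ /=.
    by rewrite !addnS addn0 trib_double_rec; ring.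
  have S1 : S m.+1 = T 1%N.
    by rewrite /S big_ord_recr /= subnn mul0r addr0 -ST addn1.
  have S2 : S m.+2 = T 2%N + trib_det m.+1.
    rewrite /S 2!big_ord_recr /= subnn mul0r addr0 -ST addn2.
    by rewrite subSnn mul1r.
  have S3 : S m.+3 = T 3%N + 2 * trib_det m.+1 + trib_det m.+2.
    rewrite /S 3!big_ord_recr /= subnn mul0r addr0 -ST addn3.
    by rewrite subSnn mul1r !subSS subSn // subSnn.
  rewrite S3 S2 S1 S0 TE; ring.
rewrite -/(S n).
(* [SE] has order three, so the induction carries three consecutive equalities; under them its
   right-hand side becomes [3 * trib_det n.+3 + 2 * trib_det n.+2]. *)
suff [] : [/\ trib_det n.+1 = S n, trib_det n.+2 = S n.+1
            & trib_det n.+3 = S n.+2] by [].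
elim: n => [|n [IH0 IH1 IH2]].
  by rewrite /S !big_ord_recr !big_ord0.
by split=> //; rewrite SE -IH0 -IH1 -IH2 trib_det_rec; ring.
Qed.

Theorem theorem13 (a : nat -> int)
    (a_def : forall n : nat, (2 <= n)%N ->
       a n = \det (toeplitz_hessenberg (-1)
                     [tuple ((trib (2 * k))%:Z : int) | k < n])) :
  [/\ a 2%N = 1,
      a 3%N = 2
    & forall n : nat, (4 <= n)%N -> a n = 3 * a (n - 1)%N + 2 * a (n - 2)%N].
Proof.
have aE n : (2 <= n)%N -> a n = trib_det n.
  move=> n_ge2; rewrite a_def //; apply: det_toeplitz_hessenbergN1 => // m lt_mn.
  rewrite trib_det_conv; apply: eq_bigr => k _; congr (_ * _).
  have lt_mkn : (m - k < n)%N by apply: leq_ltn_trans lt_mn; apply: leq_subr.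
  by rewrite -[(m - k)%N]/(val (Ordinal lt_mkn)) -tnth_nth tnth_mktuple.
split; [exact: aE | exact: aE |].
case=> [|[|[|[|n]]]] // _.
by rewrite !subSS !subn0 !aE.
Qed.
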